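(* Let $\pi\in\mathfrak{S}_n$ be indecomposable, $G=G_\pi$, and $s\in[n]$ a sink. For every spanning tree $T$ of $G$, the number $\mathrm{ext}(T)$ of edges of $G$ that are externally active for the order $\prec_T$ equals $\mathrm{level}(\phi_{TC}(T))$, where $\phi_{TC}(T)=c(T)$ is the configuration with $c_i(T)=\lambda_i(T)+\mu_i(T)+\nu_i(T)$.
   Context: $G_\pi$: vertex set $[n]$, with $a<b$ adjacent iff $b$ appears before $a$ in $\pi$; indecomposable means no $k<n$ with $\{\pi_1,\ldots,\pi_k\}=[k]$. Root $T$ at $s$; $h(i)$ is the distance to $s$ in $T$, $p(i)$ the parent of $i\neq s$, $T^{(k)}=\{i:h(i)=k\}$, $N_G(i)$ the neighbourhood in $G$. $\lambda_i(T)=|N_G(i)\cap T^{(>h(i))}|$, $\mu_i(T)=|N_G(i)\cap T^{(h(i))}|$, $\nu_i(T)=|\{j\in N_G(i)\cap T^{(h(i)-1)}:j<p(i)\}|$ for $i\ne s$, $\nu_s(T)=0$. $\mathrm{level}(c)=\sum_ic_i-|E(G)|$. The order $\prec_T$ on $E(G)$: visit the vertices of $T$ height by height ($0,1,2,\ldots$), and within a given height in decreasing order of labels. When visiting $v$, let $S$ be the set of edges $\{v,w\}$ of $G$ with $w$ not yet visited; append the edges of $S$ after all previously ordered edges, ordered among themselves by $\{v,w\}\prec_T\{v,w'\}$ iff $w>w'$. Stop once all edges are ordered. An edge $e\notin T$ is externally active for a total order $\prec$ if it is the $\prec$-maximal edge of the unique cycle in $T\cup\{e\}$; $\mathrm{ext}(T)$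 is the number of such edges. *)

(* Defs.v *)
From HB Require Import structures.
From mathcomp Require Import all_boot all_order all_algebra all_fingroup.

Set Implicit Arguments.
Unset Strict Implicit.
Unset Printing Implicit Defensive.

(* A simple graph on a finite vertex type [V] is given by its edge set,
   a set of two-element subsets of [V]. *)
Section Graphs.
Variable V : finType.
Implicit Types (E T C : {set {set V}}) (e f : {set V}) (u v : V).

Definition adj E : rel V := fun u v => [set u; v] \in E.

Definition nbhd E u : {set V} := [set v | adj E u v].

Definition cycle_edges (c : seq V) : {set {set V}} :=
  [set [set v; next c v] | v in c].

(* A duplicate-free sequence has at most [#|V|] terms, so bounding the length
   loses nothing; it makes the predicate boolean. *)
Definition is_cycle C : bool :=
  [exists c : #|V|.-bseq V, [&& 2 < size c, uniq c & C == cycle_edges c]].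

Definition connected_graph E : Prop := forall u v, connect (adj E) u v.

Definition acyclic_graph E : Prop := forall C, is_cycle C -> ~~ (C \subset E).

Definition spanning_tree E T : Prop :=
  [/\ T \subset E, connected_graph T & acyclic_graph T].

(* Least length of a walk from [u] to [v]; equal to [#|V|] if there is none. *)
Definition dist E u v : nat :=
  find (fun k => [exists p : k.-tuple V, path (adj E) u p && (last u p == v)])
       (iota 0 #|V|).

(* When [T] is a spanning tree and [e] is not in [T], the cycle [C] contained
   in [e |: T] is unique. *)
Definition externally_active (lt : rel {set V}) T e : bool :=
  (e \notin T) &&
  [exists C : {set {set V}},
    [&& is_cycle C, C \subset e |: T, e \in C
      & [forall f in C, (f != e) ==> lt f e]]].

Definition ext E (lt : rel {set V}) T : nat :=
  #|[set e in E | externally_active lt T e]|.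

End Graphs.

(* The labels 1, ..., n are represented by the ordinals 0, ..., n - 1, and
   [pi i] is the letter in position [i] of the one-line notation of [pi]. *)

Definition indecomposable n (pi : 'S_n) : Prop :=
  forall k, 0 < k < n ->
    [set pi i | i : 'I_n & i < k] != [set i : 'I_n | i < k].

(* [(pi^-1)%g a] is the position of the letter [a]. *)
Definition perm_graph n (pi : 'S_n) : {set {set 'I_n}} :=
  [set [set ab.1; ab.2] | ab : 'I_n * 'I_n
     & (ab.1 < ab.2) && ((pi^-1)%g ab.2 < (pi^-1)%g ab.1)].

Section RootedTree.
Variables (n : nat) (E : {set {set 'I_n}}) (s : 'I_n) (T : {set {set 'I_n}}).
Implicit Types i v w : 'I_n.

Definition height i : nat := dist T i s.

(* The [T]-neighbour of [i] that is closer to [s]; the default is only used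
   for [i = s]. *)
Definition parent i : 'I_n :=
  odflt i [pick j | adj T i j && (height j < height i)].

Definition lambda i : nat := #|[set j in nbhd E i | height i < height j]|.

Definition mu i : nat := #|[set j in nbhd E i | height j == height i]|.

Definition nu i : nat :=
  if i == s then 0
  else #|[set j in nbhd E i | (height j == (height i).-1) && (j < parent i)]|.

Definition phi_TC : {ffun 'I_n -> nat} :=
  [ffun i => lambda i + mu i + nu i].

Definition decreasing_labels : seq 'I_n := rev (enum 'I_n).

(* In a tree on [n] vertices all heights are smaller than [n]. *)
Definition visit_order : seq 'I_n :=
  flatten [seq [seq v <- decreasing_labels | height v == k] | k <- iota 0 n].

(* [vs] lists the vertices still to be visited, in the order of their visit. *)
Fixpoint edges_from (vs : seq 'I_n) : seq {set 'I_n} :=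
  if vs is v :: vs' then
    [seq [set v; w] | w <- decreasing_labels & (w \in vs') && adj E v w]
      ++ edges_from vs'
  else [::].

Definition edge_order : seq {set 'I_n} := edges_from visit_order.

Definition prec : rel {set 'I_n} :=
  fun e f => index e edge_order < index f edge_order.

End RootedTree.

(* The sum ranges over all vertices, the sink included. *)
Definition level n (E : {set {set 'I_n}}) (c : {ffun 'I_n -> nat}) : int :=
  ((\sum_i c i)%:Z - #|E|%:Z)%R.

(* Main.v *)
Require Import Defs.
From HB Require Import structures.
From mathcomp Require Import all_boot all_order all_algebra all_fingroup.
From mathcomp Require Import zify.

Set Implicit Arguments.
Unset Strict Implicit.
Unset Printing Implicit Defensive.

(** Direct every edge [{i, j}] of the graph so that [height j <= height i].
    If the heights agree, the fundamental cycle of the edge only has tree edges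
    visited from smaller heights, so the edge is active. If [height j < height i],
    every cycle through the edge contains the tree edge [{i, parent i}], and the
    other tree edges of the fundamental cycle are visited from heights below
    that of [j] as soon as [height j = height i - 1]; hence the edge is active
    iff [parent i] is visited strictly before [j], that is iff [j] is counted by
    [nu i]. On the other side, [lambda] counts the edges with ends of distinct
    heights once and [mu] counts the others twice, so the level is the number
    of edges with ends of equal heights plus the sum of the [nu i]. *)

(** * Closing paths into cycles, and counting edges by orientations *)

Section Graphs.
Variable V : finType.
Implicit Types (E F C : {set {set V}}) (e : {set V}) (u v w : V).

Lemma adjC E u v : adj E u v = adj E v u.
Proof. by rewrite /adj setUC. Qed.

Lemma set2_inj u v w x :
  [set u; v] = [set w; x] -> (u = w /\ v = x) \/ (u = x /\ v = w).
Proof.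
move=> eq_e.
have: u \in [set w; x] by rewrite -eq_e set21.
have: v \in [set w; x] by rewrite -eq_e set22.
have: w \in [set u; v] by rewrite eq_e set21.
have: x \in [set u; v] by rewrite eq_e set22.
rewrite !inE => /orP[]/eqP-> /orP[]/eqP-> /orP[]/eqP ? /orP[]/eqP ?;
  subst; auto.
Qed.

Definition loopless E := forall u, ~~ adj E u u.

Lemma adj_neq E u v : loopless E -> adj E u v -> u != v.
Proof. by move=> noloop uv; apply: contraTneq uv => ->. Qed.

Lemma looplessW E F : F \subset E -> loopless E -> loopless F.
Proof. by move=> /subsetP sFE noloop u; apply: contra (noloop u); apply: sFE. Qed.

Lemma next_last (u : V) (p : seq V) :
  uniq (u :: p) -> next (u :: p) (last u p) = u.
Proof. by move=> Up; rewrite next_nth mem_last index_last // nth_default. Qed.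

(** A duplicate-free path of [F] from [u] to [v] is closed up by the new edge. Since that edge is
    not in [F], the path has at least three vertices, as [is_cycle] requires. *)
Lemma connect_cycle F u v :
  u != v -> [set u; v] \notin F -> connect (adj F) u v ->
  exists C, [/\ is_cycle C, [set u; v] \in C & C \subset [set u; v] |: F].
Proof.
move=> neq_uv uvF /connectP[p0 up0 eq_v].
have {p0 up0 eq_v} [p up [Up eq_v]] :
  exists2 p, path (adj F) u p & uniq (u :: p) /\ v = last u p.
  by move: eq_v; case/shortenP: up0 => p up Up _ eq_v; exists p.
have szp : 2 < size (u :: p).
  case: p up {Up} eq_v => [|x [|y p]] //=.
    by move=> _ eq_v; rewrite eq_v eqxx in neq_uv.
  by rewrite andbT => ux eq_v; rewrite eq_v in uvF; case/negP: uvF.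
have szV : size (u :: p) <= #|V| by rewrite -(card_uniqP Up) max_card.
have cyc : path.cycle (adj ([set u; v] |: F)) (u :: p).
  rewrite /= rcons_path -eq_v adjC /adj setU11 andbT.
  by apply: sub_path up => x y; rewrite /adj in_setU => ->; rewrite orbT.
exists (cycle_edges (u :: p)); split.
- by apply/existsP; exists (Bseq szV); rewrite szp Up eqxx.
- apply/imsetP; exists v; first by rewrite eq_v mem_last.
  by rewrite eq_v next_last // setUC.
- by apply/subsetP => f /imsetP[x xc ->]; apply: (next_cycle cyc).
Qed.

(** Rotate the cycle so that it starts at [w]: the second and the last vertex are then its
    neighbours, distinct because the length exceeds two. *)
Lemma is_cycleP C w : is_cycle C -> (exists2 e, e \in C & w \in e) ->
  exists x y, [/\ x != y, [set w; x] \in C & [set w; y] \in C].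
Proof.
case/existsP=> c /and3P[szc Uc /eqP->] [e /imsetP[v vc ->] wv].
have wc : w \in (c : seq V).
  by move: wv; rewrite !inE => /orP[]/eqP->; rewrite ?mem_next.
have [k c' def_c] := rot_to wc.
have edge x y : x \in rot k c -> next (rot k c) x = y ->
    [set x; y] \in cycle_edges c.
  rewrite mem_rot next_rot // => xc <-; exact: imset_f.
move: Uc szc edge; rewrite -(rot_uniq k) -(size_rot k) def_c.
case: c' {def_c} => [|x [|y c']] //= Uc _ edge.
exists x, (last y c'); split.
- by case/and3P: Uc => _ xyc' _; apply: contraNneq xyc' => ->; apply: mem_last.
- by apply: edge; rewrite ?mem_head // eqxx.
- rewrite setUC; apply: edge; first by rewrite 2!in_cons mem_last !orbT.
  exact: (@next_last w [:: x, y & c']).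
Qed.

(** A strict total order on the vertices picks exactly one orientation of each edge. *)
Lemma card_edges E (R : rel V) :
  irreflexive R -> transitive R -> (forall u v, u != v -> R u v || R v u) ->
  (forall e, e \in E -> #|e| = 2) ->
  #|E| = \sum_u \sum_v (adj E u v && R u v).
Proof.
move=> Rirr Rtr Rtot E2.
pose D := [set uv : V * V | adj E uv.1 uv.2 && R uv.1 uv.2].
have def_E : E = [set [set uv.1; uv.2] | uv in D].
  apply/setP=> e; apply/idP/imsetP => [eE | [[u v] + ->]]; last first.
    by rewrite inE => /andP[].
  have /cards2P[u [v [neq_uv def_e]]] : #|e| == 2 by rewrite E2.
  rewrite def_e in eE *; have /orP[uv|vu] := Rtot _ _ neq_uv.
    by exists (u, v) => //; rewrite inE /= uv andbT.
  by exists (v, u); rewrite 1?setUC //= inE /= vu andbT /adj setUC.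
rewrite {1}def_E card_in_imset; last first.
  move=> [u v] [w x]; rewrite !inE /= => /andP[_ uv] /andP[_ wx].
  case/set2_inj=> [[-> ->] // | [eu ev]].
  by move: uv; rewrite eu ev => /(Rtr _ _ _ wx); rewrite Rirr.
rewrite -sum1_card big_mkcond pair_bigA.
by apply: eq_bigr => -[u v] _; rewrite inE; case: ifP.
Qed.

End Graphs.

(** * Heights, parents and cycles in the rooted tree *)

Section Heights.
Variables (n : nat) (E T : {set {set 'I_n}}) (s : 'I_n).
Hypothesis noloop : loopless E.
Hypothesis treeT : spanning_tree E T.
Implicit Types (e f : {set 'I_n}) (C : {set {set 'I_n}}) (i j u v w : 'I_n).

Notation h := (height s T).
Notation p := (parent s T).

Let sTE : T \subset E. Proof. by case: treeT. Qed.
Let noloopT : loopless T := looplessW sTE noloop.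

(** A shortened path to [s] has fewer than [n] edges, so the search in [dist] succeeds and its
    default value never occurs. *)
Lemma heightP i : h i < n /\
  exists2 q, path (adj T) i q & last i q = s /\ size q = h i.
Proof.
rewrite /height /dist card_ord; set P := (fun _ => _).
have [q [szq iq lq]] : exists q, [/\ size q < n, path (adj T) i q & last i q = s].
  have [_ /(_ i s)/connectP[q0 iq0 ->] _] := treeT.
  case/shortenP: iq0 => q iq Uq _; exists q; split=> //.
  by have := max_card [in i :: q]; rewrite (card_uniqP Uq) card_ord.
have hasP : has P (iota 0 n).
  apply/hasP; exists (size q); first by rewrite mem_iota.
  by apply/existsP; exists (in_tuple q); rewrite iq lq eqxx.
have lt_n : find P (iota 0 n) < n by rewrite has_find size_iota in hasP.
split=> //; have := nth_find 0 hasP; rewrite nth_iota // add0n.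
by case/existsP=> r /andP[ir /eqP lr]; exists r; rewrite ?size_tuple.
Qed.

Lemma height_le i q : path (adj T) i q -> last i q = s -> h i <= size q.
Proof.
move=> iq lq; rewrite leqNgt; apply/negP => lt_qh.
have [lt_hn _] := heightP i; have lt_qn := ltn_trans lt_qh lt_hn.
move: lt_qh; rewrite /height /dist card_ord => /(before_find 0).
rewrite nth_iota // add0n => /existsP[]; exists (in_tuple q).
by rewrite iq lq eqxx.
Qed.

Lemma height_adj i j : adj T i j -> h i <= (h j).+1.
Proof.
move=> ij; have [_ [q jq [lq <-]]] := heightP j.
by apply: (@height_le i (j :: q)); rewrite //= ij.
Qed.

Lemma height_eq0 i : (h i == 0) = (i == s).
Proof.
apply/eqP/eqP => [hi0 | ->]; last first.
  by apply/eqP; rewrite -leqn0; apply: (@height_le s [::]).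
by have [_ [q _ []]] := heightP i; rewrite hi0 => <- /size0nil ->.
Qed.

Lemma parentP i : i != s -> adj T i (p i) /\ h i = (h (p i)).+1.
Proof.
rewrite -height_eq0 => hi_neq0.
have [adj_p lt_p] : adj T i (p i) /\ h (p i) < h i.
  rewrite /parent; case: pickP => [j /andP[] // | nojj] /=.
  have [_ [[|j q] /=]] := heightP i.
    by move=> _ [_ hi0]; rewrite -hi0 in hi_neq0.
  case/andP=> ij jq [lq hi]; have := nojj j.
  by rewrite ij -hi ltnS (height_le jq lq).
by split=> //; apply/eqP; rewrite eqn_leq lt_p (height_adj adj_p).
Qed.

(** The subtree of [T] on the vertices of height at most [m]. It connects two such vertices without
    any need to describe the tree path between them. *)
Definition parent_edges m := [set [set w; p w] | w : 'I_n & (w != s) && (h w <= m)].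

Lemma parent_edges_sub m : parent_edges m \subset T.
Proof.
by apply/subsetP=> f /imsetP[w]; rewrite inE => /andP[/parentP[wp _] _] ->.
Qed.

Lemma connect_parent_edges m i : h i <= m -> connect (adj (parent_edges m)) i s.
Proof.
have [k] : exists k, h i = k by exists (h i).
elim: k i => [|k IH] i hi le_m.
  by move/eqP: hi; rewrite height_eq0 => /eqP->.
have nis : i != s by rewrite -height_eq0 hi.
have [_] := parentP nis; rewrite hi => -[hp].
have le_pm : h (p i) <= m by lia.
apply: connect_trans (IH (p i) (esym hp) le_pm).
by apply: connect1; apply/imsetP; exists i; rewrite // inE nis le_m.
Qed.

Lemma connect_parent_edges2 m i j :
  h i <= m -> h j <= m -> connect (adj (parent_edges m)) i j.
Proof.
move=> hi hj; apply: connect_trans (connect_parent_edges hi) _.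
by rewrite (sym_connect_sym (@adjC _ _)) connect_parent_edges.
Qed.

(** Any other tree edge would close a cycle with the parent edges, against the acyclicity of [T]. *)
Lemma adj_parent u v : adj T u v -> h u <= h v -> v != s /\ u = p v.
Proof.
move=> uv le_uv; have neq_uv := adj_neq noloopT uv.
have nvs : v != s.
  apply: contraNneq neq_uv => vs; have /eqP hs0 : h s == 0 by rewrite height_eq0.
  by move: le_uv; rewrite vs hs0 leqn0 height_eq0.
split=> //; apply/eqP; apply: contraT => nup.
have uvF : [set u; v] \notin parent_edges (h v).
  apply/imsetP => -[w]; rewrite inE => /andP[nws _] /set2_inj[[uw vp] | [up vw]].
    have [_] := parentP nws; rewrite -vp -uw; lia.
  by rewrite up vw eqxx in nup.
have [C [cycC _ sC]] := connect_cycle neq_uv uvF (connect_parent_edges2 le_uv (leqnn _)).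
case: treeT => _ _ /(_ C cycC) /negP[].
apply: subset_trans sC _; rewrite subUset sub1set parent_edges_sub andbT.
exact: uv.
Qed.

(** Take a vertex [w] of maximal height on [C]. Of its two edges on [C], any one other than
    [[set i; j]] leads to [p w], so one of them is [[set i; j]]. As [j] is lower than [i], this
    forces [w = i], and the other edge is the one sought. *)
Lemma cycle_parent_edge C i j : is_cycle C -> [set i; j] \in C ->
  C \subset [set i; j] |: T -> h j < h i -> [set i; p i] \in C.
Proof.
move=> cycC ijC sC lt_ji.
pose inC w := [exists e in C, w \in e].
have inCi : inC i by apply/existsP; exists [set i; j]; rewrite ijC set21.
case: (arg_maxnP h inCi) => w /existsP[e /andP[eC we]] max_w.
have [x [y [nxy wxC wyC]]] : exists x y, [/\ x != y, [set w; x] \in C & [set w; y] \in C].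
  by apply: is_cycleP => //; exists e.
have le_w z : [set w; z] \in C -> h z <= h w.
  by move=> wzC; apply: max_w; apply/existsP; exists [set w; z]; rewrite wzC set22.
have parent_w z : [set w; z] \in C -> [set w; z] != [set i; j] -> z = p w.
  move=> wzC nwz; have := subsetP sC _ wzC; rewrite in_setU1 (negPf nwz) /= => wz.
  by have [] := adj_parent (_ : adj T z w) (le_w z wzC); rewrite // adjC.
have nwj : w != j.
  by apply: contraTneq (max_w i inCi) => ->; rewrite -ltnNge.
have [wi | nwi] := eqVneq w i; last first.
  have not_e z : [set w; z] != [set i; j].
    by apply/eqP=> /set2_inj[[/eqP]|[/eqP]]; rewrite ?(negPf nwi) ?(negPf nwj).
  by case/eqP: nxy; rewrite (parent_w x) // (parent_w y).
have {}parent_w z : [set w; z] \in C -> z != j -> [set i; p i] \in C.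
  move=> wzC nzj; rewrite -wi -(parent_w z wzC) //.
  apply/eqP; rewrite -wi => /set2_inj[[_ /eqP]|[/eqP]].
    by rewrite (negPf nzj).
  by rewrite (negPf nwj).
have [xj|] := eqVneq x j; last exact: parent_w.
by apply: (parent_w y); rewrite // -xj eq_sym.
Qed.

(** * The order of visit and the induced order on edges *)

Definition before : rel 'I_n :=
  fun i j => (h i < h j) || (h i == h j) && (j < i).

Lemma before_irr : irreflexive before.
Proof. by move=> i; rewrite /before !ltnn andbF. Qed.

Lemma before_trans : transitive before.
Proof. by move=> j i k; rewrite /before; lia. Qed.

Lemma before_total i j : i != j -> before i j || before j i.
Proof. by rewrite -val_eqE /before /=; lia. Qed.

Lemma pairwise_visit_order : pairwise before (visit_order s T).
Proof.
have dec : pairwise (fun i j : 'I_n => j < i) (decreasing_labels n).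
  rewrite -sorted_pairwise; last by move=> j i k /= ji /ltn_trans->.
  by rewrite rev_sorted -(sorted_map (e' := ltn)) val_enum_ord iota_ltn_sorted.
(* The number of height blocks is abstracted apart from the [n] of ['I_n], and the starting height
   is generalised for the induction. *)
rewrite /visit_order; set l := (X in iota _ X).
elim: l 0 => //= l IH m.
rewrite pairwise_cat IH andbT; apply/andP; split.
  apply/allrelP => i j; rewrite mem_filter => /andP[/eqP hi _].
  case/flattenP=> _ /mapP[k + ->]; rewrite mem_iota => /andP[lt_mk _].
  by rewrite mem_filter => /andP[/eqP hj _]; rewrite /before hi hj lt_mk.
apply: (sub_in_pairwise (P := [pred i | h i == m]) (r := fun i j => j < i));
  last exact: pairwise_filter.
- by move=> i j /eqP hi /eqP hj lt_ji; rewrite /before hi hj eqxx lt_ji orbT.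
- exact: filter_all.
Qed.

Lemma mem_visit_order i : i \in visit_order s T.
Proof.
apply/flattenP; exists [seq v <- decreasing_labels n | h v == h i].
  by apply: map_f; rewrite mem_iota; have [] := heightP i.
by rewrite mem_filter eqxx mem_rev mem_enum.
Qed.

(** An edge is listed when its earlier end is visited, so [[set a; b]] lies in the block of [a], and
    [[set c; d]] in no block up to that one. The latter need not be an edge: an absent entry has the
    length of the list as index. *)
Lemma index_edges_from (vs : seq 'I_n) a b c d :
  pairwise before vs -> a \in vs -> b \in vs -> c \in vs -> d \in vs ->
  adj E a b -> before a b -> before c d -> before a c ->
  index [set a; b] (edges_from E vs) < index [set c; d] (edges_from E vs).
Proof.
move=> pvs + + + + ab lt_ab lt_cd lt_ac; elim: vs pvs => //= v vs IH /andP[allv pvs].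
have lt_neq x y : before x y -> y != x.
  by move=> lt_xy; apply: contraTneq lt_xy => ->; rewrite before_irr.
have lt_ad := before_trans lt_ac lt_cd.
have in_vs x y : y \in v :: vs -> before x y -> x \in v :: vs -> y \in vs.
  rewrite !inE => /predU1P[-> | //] lt_xv /predU1P[eq_xv | xvs].
    by rewrite eq_xv before_irr in lt_xv.
  by have := before_trans lt_xv (allP allv x xvs); rewrite before_irr.
move=> av bv cv dv.
have bvs := in_vs _ _ bv lt_ab av; have cvs := in_vs _ _ cv lt_ac av.
have dvs := in_vs _ _ dv lt_ad av.
rewrite !index_cat.
set blk := [seq _ | _ <- _ & _].
have notin_blk x y : x != v -> y != v -> ([set x; y] \in blk) = false.
  move=> nxv nyv; apply/mapP => -[w _] /set2_inj[[/eqP]|[_ /eqP]].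
    by rewrite (negPf nxv).
  by rewrite (negPf nyv).
have neq_v x : x \in vs -> x != v by move=> /(allP allv)/lt_neq.
rewrite (notin_blk c d) ?neq_v //.
move: av; rewrite inE => /predU1P[eq_av | avs]; last first.
  by rewrite notin_blk ?neq_v // ltn_add2l IH.
have in_blk : [set a; b] \in blk.
  rewrite eq_av; apply: map_f; rewrite mem_filter mem_rev mem_enum andbT bvs.
  by rewrite -eq_av.
by rewrite in_blk ltn_addr // index_mem.
Qed.

Lemma prec_before a b c d :
  adj E a b -> before a b -> before c d -> before a c ->
  prec E s T [set a; b] [set c; d].
Proof.
by apply: index_edges_from; rewrite ?mem_visit_order ?pairwise_visit_order.
Qed.

(** * Which edges are externally active *)

Lemma activeI (F : {set {set 'I_n}}) i j :
  adj E i j -> [set i; j] \notin T -> F \subset T -> connect (adj F) i j ->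
  (forall f, f \in F -> prec E s T f [set i; j]) ->
  externally_active (prec E s T) T [set i; j].
Proof.
move=> ij eT sF conn lt_e; rewrite /externally_active eT /=.
have eF : [set i; j] \notin F by apply: contra eT; apply: (subsetP sF).
have [C [cycC eC sC]] := connect_cycle (adj_neq noloop ij) eF conn.
apply/existsP; exists C; rewrite cycC eC (subset_trans sC) ?setUS //=.
apply/forall_inP => f fC; apply/implyP => nfe; apply: lt_e.
by have := subsetP sC f fC; rewrite in_setU1 (negPf nfe).
Qed.

(** A parent edge is listed at the visit of [p w], its end of smaller height. *)
Lemma prec_parent_edge w a b : w != s -> before a b -> before (p w) a ->
  prec E s T [set w; p w] [set a; b].
Proof.
move=> /parentP[wp hw] lt_ab lt_pa; rewrite setUC.
apply: prec_before => //; last by rewrite /before hw ltnSn.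
by rewrite adjC; apply: (subsetP sTE).
Qed.

Lemma active_same i j : adj E i j -> h i = h j ->
  externally_active (prec E s T) T [set i; j].
Proof.
move=> ij eq_h; have nij := adj_neq noloop ij.
wlog lt_ij : i j ij eq_h nij / before i j => [wlog_ij|].
  have /orP[|lt_ji] := before_total nij; first exact: wlog_ij.
  by rewrite setUC; apply: wlog_ij; rewrite // 1?adjC 1?eq_sym.
(* These edges are listed from parents of height less than [h i], hence before [i] is visited. *)
apply: (activeI (F := parent_edges (h i))); rewrite ?parent_edges_sub //.
- apply/negP => /adj_parent; rewrite eq_h => /(_ (leqnn _))[/parentP[_ hj] ip].
  by move: eq_h; rewrite hj -ip; lia.
- by rewrite connect_parent_edges2 ?eq_h.
move=> f /imsetP[w]; rewrite inE => /andP[nws le_wi] ->.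
apply: prec_parent_edge => //; have [_ hw] := parentP nws.
by rewrite /before -hw le_wi.
Qed.

Lemma active_down i j : adj E i j -> h j < h i ->
  externally_active (prec E s T) T [set i; j] = (h j == (h i).-1) && (j < p i).
Proof.
move=> ij lt_h; have nis : i != s by rewrite -height_eq0; lia.
have [adj_p hi] := parentP nis; rewrite hi /=.
have lt_ji : before j i by rewrite /before lt_h.
have [/andP[/eqP hj lt_jp] | not_nu] := boolP (_ && _).
  (* The path steps from [i] to [p i], which has the height of [j], and then stays in the subtree up
     to that height. *)
  apply: (activeI (F := [set i; p i] |: parent_edges (h j))) => //.
  - apply/negP => ijT; have [] := adj_parent (_ : adj T j i) (ltnW lt_h).
      by rewrite adjC.
    by move=> _ jp; rewrite -jp ltnn in lt_jp.
  - by rewrite subUset sub1set parent_edges_sub andbT.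
  - apply: (@connect_trans _ _ (p i)).
      by apply: connect1; rewrite /adj setU11.
    apply: (@connect_sub _ (adj (parent_edges (h j)))); last first.
      by apply: connect_parent_edges2; rewrite ?hj.
    by move=> x y xy; apply: connect1; rewrite /adj in_setU1 -/(adj _ x y) xy orbT.
  move=> f; rewrite [[set i; j]]setUC in_setU1 => /predU1P[-> | /imsetP[w]].
    by apply: prec_parent_edge; rewrite // /before hj eqxx lt_jp orbT.
  rewrite inE => /andP[nws le_wj] ->; apply: prec_parent_edge => //.
  by have [_ hw] := parentP nws; rewrite /before -hw le_wj.
(* Conversely, the cycle contains [[set i; p i]], and [p i != j] because [[set i; j]] is not in [T].
   If the condition failed, [j] would be visited before [p i], and [[set i; j]] would not be
   maximal. *)
apply: contraNF not_nu => /andP[ijT /existsP[C /and4P[cycC sC ijC /forall_inP max_ij]]].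
have npj : p i != j by apply: contraNneq ijT => <-.
have ne : [set i; p i] != [set i; j].
  apply/eqP => /set2_inj[[_ /eqP]|[eq_ij]]; first by rewrite (negPf npj).
  by rewrite eq_ij ltnn in lt_h.
have := implyP (max_ij _ (cycle_parent_edge cycC ijC sC lt_h)) ne.
rewrite /prec => lt_pj; apply: contraLR lt_pj => not_nu.
rewrite -leqNgt ltnW // [[set i; j]]setUC [[set i; p i]]setUC.
apply: prec_before; rewrite 1?adjC //; first by rewrite /before hi ltnSn.
by move: not_nu npj lt_h; rewrite -val_eqE /before hi /=; lia.
Qed.

(** Every term becomes a sum [S] over ordered pairs of adjacent vertices; both sides then equal
    [S lower + S same + S same + S act]. *)
Lemma ext_phi_TC (E2 : forall e, e \in E -> #|e| = 2) :
  ext E (prec E s T) T + #|E| = \sum_i phi_TC E s T i.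
Proof.
pose S (P : rel 'I_n) := \sum_u \sum_v (adj E u v && P u v : nat).
have S_swap P : S P = S (fun u v => P v u).
  rewrite /S exchange_big; apply: eq_bigr => u _; apply: eq_bigr => v _.
  by rewrite adjC.
have S_split (P Q R : rel 'I_n) :
    (forall u v, adj E u v -> P u v = Q u v + R u v :> nat) -> S P = S Q + S R.
  move=> eqP; rewrite /S -big_split; apply: eq_bigr => u _.
  rewrite -big_split; apply: eq_bigr => v _ /=.
  by case: (boolP (adj E u v)) => //= /eqP->.
pose lower u v := h u < h v.
pose same u v := (h u == h v) && (v < u).
(* The first conjunct makes [act u s] false, in agreement with [nu] at [s]; for [v != s] it follows
   from the second. *)
pose act u v := (h u < h v) && ((h u == (h v).-1) && (u < p v)).
have card_set (Q : pred 'I_n) : #|[set j | Q j]| = \sum_j (Q j : nat).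
  by rewrite -sum1dep_card big_mkcond; apply: eq_bigr => j _; case: (Q j).
have card_nbhd u (P : pred 'I_n) :
    #|[set j in nbhd E u | P j]| = \sum_v (adj E u v && P v : nat).
  by rewrite card_set; apply: eq_bigr => v _; rewrite inE.
have card_E : #|E| = S lower + S same.
  rewrite (card_edges before_irr before_trans before_total E2).
  by apply: S_split => u v _; rewrite /before /lower /same; case: ltngtP.
have card_ext : ext E (prec E s T) T = S act + S same.
  rewrite /ext (card_edges before_irr before_trans before_total); last first.
    by move=> e; rewrite inE => /andP[/E2].
  rewrite -(S_split (fun u v =>
    externally_active (prec E s T) T [set u; v] && before u v)).
    apply: eq_bigr => u _; apply: eq_bigr => v _.
    by rewrite {1}/adj inE andbA.
  move=> u v uv; rewrite /before /act /same; case: ltngtP => /= [lt_uv | _ | eq_uv].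
  - by rewrite andbT addn0 setUC active_down // adjC.
  - by rewrite andbF.
  - by rewrite active_same.
have sum_lambda : \sum_i lambda E s T i = S lower.
  by apply: eq_bigr => i _; rewrite /lambda card_nbhd.
have sum_mu : \sum_i mu E s T i = S same + S same.
  (* An edge between equal heights is seen by [mu] from both ends: [same] and its transpose. *)
  rewrite {2}S_swap -(S_split (fun u v => h v == h u)).
    by apply: eq_bigr => i _; rewrite /mu card_nbhd.
  move=> u v /(adj_neq noloop); rewrite -val_eqE /same [h v == _]eq_sym /=.
  by case: (h u == h v) => //=; case: ltngtP.
have sum_nu : \sum_i nu E s T i = S act.
  rewrite S_swap; apply: eq_bigr => i _; rewrite /nu.
  case: eqVneq => [-> | nis].
    rewrite big1 // => j _; rewrite /act.
    by have /eqP-> : h s == 0; rewrite ?height_eq0 // ltn0 andbF.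
  rewrite card_nbhd; apply: eq_bigr => j _; congr (nat_of_bool (_ && _)).
  rewrite /act; have [_ ->] := parentP nis; rewrite /=; lia.
under eq_bigr => i _ do rewrite ffunE.
rewrite !big_split /= sum_lambda sum_mu sum_nu card_ext card_E; lia.
Qed.

End Heights.

Lemma card_perm_graph_edge n (pi : 'S_n) e : e \in perm_graph pi -> #|e| = 2.
Proof.
case/imsetP => -[a b]; rewrite inE /= => /andP[lt_ab _] ->.
by rewrite cards2 -val_eqE /= neq_ltn lt_ab.
Qed.

Theorem theorem3p8 (n : nat) (pi : 'S_n) (s : 'I_n) (T : {set {set 'I_n}}) :
  indecomposable pi ->
  spanning_tree (perm_graph pi) T ->
  (ext (perm_graph pi) (prec (perm_graph pi) s T) T)%:Z%R
    = level (perm_graph pi) (phi_TC (perm_graph pi) s T).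
Proof.
move=> _ treeT; have E2 := @card_perm_graph_edge n pi.
have noloop : loopless (perm_graph pi).
  by move=> u; apply/negP => /E2; rewrite setUid cards1.
by rewrite /level -(ext_phi_TC s noloop treeT E2); lia.
Qed.
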